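(* Let $\mathbb M\subseteq\mathbb R^{d\times d}$ be an arbitrary subset of matrices and suppose $\alpha\in I$. Let $\lambda>0$. On the event $\{\|\mathcal R_n\|_\infty\le\lambda\}$ we have $$\big\|\big(\tilde{\Sigma}_{n,\lambda}-\Sigma,\,U^{-2}(\tilde\alpha_{n,\lambda}-\alpha)\big)\big\|_{w}^{2}\le\inf_{M\in\mathbb{M}}\Big\{\|M-\Sigma\|_{w}^{2}+2\lambda\big(\|M\|_{1}+U^{-2}\alpha\big)\Big\}.$$
   Context: Model. $X=(X_t)_{t\ge0}$ is a $d$-dimensional Lévy process with diffusion matrix $\Sigma\in\mathbb R^{d\times d}$ (positive semi-definite), drift $\gamma\in\mathbb R^d$ and jump measure $\nu$, so $\mathbb E[e^{i\langle X_t,u\rangle}]=e^{t\psi(u)}$ with $\psi(u)=-\frac12\langle u,\Sigma u\rangle+\Psi(u)$, $\Psi(u)=i\langle\gamma,u\rangle+\int_{\mathbb R^d}(e^{i\langle x,u\rangle}-1-i\langle x,u\rangle\mathbf 1_{\{|x|\le1\}})\,\nu(\mathrm dx)$. $\mathcal T$ is a non-decreasing right-continuous process with left limits, $\mathcal T(0)=0$, independent of $X$, whose increments $T_j=\mathcal T(j)-\mathcal T(j-1)$ are stationary with law $\pi$ on $\mathbb R_+$; $\mathscr L(z)=\int_0^\infty e^{-tz}\pi(\mathrm dt)$ is known. One observes $Y_j=X_{\mathcal T(j)}-X_{\mathcal T(j-1)}$, $j=1,\dots,n$. Put $\phi_n(u)=\frac1n\sum_{j=1}^ne^{i\langle u,Y_j\rangle}$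 and $\hat\psi_n(u)=-\mathscr L^{-1}(\phi_n(u))$, where $\mathscr L^{-1}$ is a continuously chosen inverse of $\{\operatorname{Re}z>0\}\ni z\mapsto\mathscr L(z)\in\mathbb C\setminus\{0\}$. Set $\alpha:=\nu(\mathbb R^d)$ if this is finite and $\alpha:=0$ if $\nu(\mathbb R^d)=\infty$. Weights. $w:\mathbb R^d\to\mathbb R_+$ is a (measurable, suitably integrable) radial function supported on $\{1/4<|u|\le1/2\}$; for $U>1$, $w_U(u)=U^{-d}w(u/U)$. Matrices. $\langle A,B\rangle=\operatorname{tr}(A^\top B)$; $\|A\|_1,\|A\|_\infty$ are the nuclear and spectral norms; $\operatorname{diag}(A,a)$ is the block-diagonal matrix with blocks $A$ and $a$. $\Theta(u)=uu^\top/|u|^2$ and $\tilde\Theta(u)=\operatorname{diag}(\Theta(u),2U^2/|u|^2)\in\mathbb R^{(d+1)\times(d+1)}$. For $A\in\mathbb R^{d\times d}$, $a\in\mathbb R$: $\|(A,a)\|_w^2=\int_{\mathbb R^d}\langle\tilde\Theta(u),\operatorname{diag}(A,a)\rangle^2w_U(u)\,\mathrm du$ and $\|A\|_w=\|(A,0)\|_w$. Estimator. For an interval $I\subseteq\mathbb R_+$, a set $\mathbb M$ of $d\times d$ matrices and $\lambda>0$, $(\tilde\Sigma_{n,\lambda},\tilde\alpha_{n,\lambda})$ is a minimiser over $M\in\mathbb M$, $a\in I$ of $$\int_{\mathbb R^d}\Big(\tfrac{2}{|u|^2}\operatorname{Re}\hat\psi_n(u)+\langle\tilde\Theta(u),\operatorname{diag}(M,U^{-2}a)\rangle\Big)^2w_U(u)\,\mathrm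 du+\lambda\big(\|M\|_1+U^{-2}a\big).$$ Error matrix. $$\mathcal R_n=2\int_{\mathbb R^d}\Big(\tfrac{2}{|u|^2}\operatorname{Re}\hat\psi_n(u)+\langle\tilde\Theta(u),\operatorname{diag}(\Sigma,U^{-2}\alpha)\rangle\Big)\tilde\Theta(u)w_U(u)\,\mathrm du\in\mathbb R^{(d+1)\times(d+1)}.$$ *)

(* Defs.v *)
From HB Require Import structures.
From mathcomp Require Import all_boot all_order all_algebra.
From mathcomp.real_closed Require Import complex.
From mathcomp Require Import all_classical all_reals all_analysis.
Import Order.TTheory GRing.Theory Num.Theory.
Import numFieldNormedType.Exports.

Set Implicit Arguments.
Unset Strict Implicit.
Unset Printing Implicit Defensive.

Local Open Scope classical_set_scope.
Local Open Scope ring_scope.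

(* Measurable structure on matrices: the product sigma-algebra, generated by
   the coordinate maps. For real column vectors this is the Borel
   sigma-algebra of R^d. *)

Definition mx_cylinders d (T : sigmaRingType d) (m n : nat) :
    set (set 'M[T]_(m, n)) :=
  [set A | exists i j, exists2 B : set T, measurable B &
     A = [set M : 'M[T]_(m, n) | B (M i j)]].

Definition measure_mx_display : measure_display -> measure_display.
Proof. exact. Qed.

Section measurable_mx.
Context {d} {T : sigmaRingType d}.
Variables m n : nat.

Let mx_set0 : <<s @mx_cylinders d T m n >> set0.
Proof. exact: sigma_algebra0. Qed.

Let mx_setC A :
  <<s @mx_cylinders d T m n >> A -> <<s @mx_cylinders d T m n >> (~` A).
Proof. exact: sigma_algebraC. Qed.

Let mx_bigcup (F : (set 'M[T]_(m, n))^nat) :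
  (forall i, <<s @mx_cylinders d T m n >> (F i)) ->
  <<s @mx_cylinders d T m n >> (\bigcup_i (F i)).
Proof. exact: sigma_algebra_bigcup. Qed.

HB.instance Definition _ := @isMeasurable.Build (measure_mx_display d)
  'M[T]_(m, n) <<s @mx_cylinders d T m n >> mx_set0 mx_setC mx_bigcup.

End measurable_mx.

Lemma measurable_mx_coord d (T : measurableType d) m n i j :
  measurable_fun [set: 'M[T]_(m, n)] (fun M : 'M[T]_(m, n) => M i j).
Proof.
move=> _ B mB; rewrite setTI; apply: sub_sigma_algebra.
by exists i, j, B.
Qed.

Lemma measurable_fun_mxP d1 d2 (T1 : measurableType d1) (T : measurableType d2)
    m n (f : T1 -> 'M[T]_(m, n)) :
  (forall i j, measurable_fun setT (fun x => f x i j)) -> measurable_fun setT f.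
Proof.
move=> mf; apply: (@measurability _ _ _ _ setT f (@mx_cylinders d2 T m n)) => //.
by move=> _ [_ [i [j [B mB ->]]] <-]; exact: (mf i j).
Qed.

(* Lebesgue measure on R^n: the n-fold product of the one-dimensional one,
   transported along the identification of R * R^n with R^(n+1). *)

Definition cv_cons (R : realType) n (p : measurableTypeR R * 'cV[R]_n) :
    'cV[R]_n.+1 :=
  \col_i (if unlift ord0 i is Some j then p.2 j ord0 else p.1).

Definition cv_uncons (R : realType) n (x : 'cV[R]_n.+1) :
    measurableTypeR R * 'cV[R]_n :=
  (x ord0 ord0, \col_i x (lift ord0 i) ord0).

Lemma cv_consK (R : realType) n : cancel (@cv_cons R n) (@cv_uncons R n).
Proof.
move=> [a v]; congr pair; first by rewrite mxE unlift_none.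
by apply/colP => i; rewrite !mxE liftK.
Qed.

Lemma cv_unconsK (R : realType) n : cancel (@cv_uncons R n) (@cv_cons R n).
Proof.
move=> x; apply/colP => i; rewrite mxE.
by have [j ->|->] := unliftP ord0 i => //=; rewrite mxE.
Qed.

Lemma measurable_cv_cons (R : realType) n :
  measurable_fun setT (@cv_cons R n).
Proof.
apply: measurable_fun_mxP => i j.
under eq_fun do rewrite mxE.
have [k _|_] := unliftP ord0 i.
  exact: (measurableT_comp (measurable_mx_coord k ord0) measurable_snd).
exact: (@measurable_fst _ _ (measurableTypeR R) 'cV[R]_n).
Qed.

Lemma measurable_cv_uncons (R : realType) n :
  measurable_fun setT (@cv_uncons R n).
Proof.
apply: measurable_fun_pair; first exact: (@measurable_mx_coord _ R).
apply: measurable_fun_mxP => i j.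
under eq_fun do rewrite mxE.
exact: measurable_mx_coord.
Qed.

Section lebesgue_step.
Context (R : realType) (n : nat).
Variable m : {sigma_finite_measure set 'cV[R]_n -> \bar R}.

Definition lebesgue_step : set 'cV[R]_n.+1 -> \bar R :=
  pushforward (@lebesgue_measure R \x m)%E (@cv_cons R n).

Let lebesgue_step0 : lebesgue_step set0 = 0%E.
Proof. by rewrite /lebesgue_step /pushforward preimage_set0 measure0. Qed.

Let lebesgue_step_ge0 A : (0 <= lebesgue_step A)%E.
Proof. by rewrite /lebesgue_step /pushforward measure_ge0. Qed.

Let lebesgue_step_sigma_additive : semi_sigma_additive lebesgue_step.
Proof.
apply: (@measure_semi_sigma_additive _ _ _
  (measure_function_pushforward__canonical__measure_function_Measure _
     (@measurable_cv_cons R n))).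
Qed.

HB.instance Definition _ := isMeasure.Build _ _ _ lebesgue_step
  lebesgue_step0 lebesgue_step_ge0 lebesgue_step_sigma_additive.

Let lebesgue_step_sigma_finite : sigma_finite setT lebesgue_step.
Proof.
have /sigma_finiteP[F [FT ndF Foo]] := sigma_finiteT (@lebesgue_measure R).
have /sigma_finiteP[G [GT ndG Goo]] := sigma_finiteT m.
exists (fun k => @cv_uncons R n @^-1` (F k `*` G k)).
  rewrite -preimage_bigcup -(preimage_setT (@cv_uncons R n)); congr (_ @^-1` _).
  rewrite -setXTT FT GT predeqE => -[x y]; split.
    move=> [/= [i _ Fix] [k _ Gky]]; exists (maxn i k) => //; split.
    - by move: x Fix; exact/subsetPset/ndF/leq_maxl.
    - by move: y Gky; exact/subsetPset/ndG/leq_maxr.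
  by move=> [k _ []/= ? ?]; split; exists k.
move=> k; have [mF Fk] := Foo k; have [mG Gk] := Goo k; split.
  rewrite -[X in measurable X]setTI.
  by apply: measurable_cv_uncons => //; exact: measurableX.
rewrite /lebesgue_step /pushforward -comp_preimage.
rewrite (_ : _ \o _ = id); last by apply/funext; exact: cv_consK.
by rewrite preimage_id product_measure1E// lte_mul_pinfty// ge0_fin_numE.
Qed.

HB.instance Definition _ := Measure_isSigmaFinite.Build _ _ _ lebesgue_step
  lebesgue_step_sigma_finite.

End lebesgue_step.

Fixpoint lebesgue_cv (R : realType) (n : nat) :
    {sigma_finite_measure set 'cV[R]_n -> \bar R} :=
  if n is k.+1 then lebesgue_step (lebesgue_cv R k) else \d_(0 : 'cV[R]_0).

Lemma lebesgue_cv_box (R : realType) n (B : 'I_n -> set R) :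
  (forall i, measurable (B i)) ->
  lebesgue_cv R n [set x | forall i, B i (x i ord0)] =
  (\prod_(i < n) @lebesgue_measure R (B i))%E.
Proof.
elim: n => [|n IHn] in B *.
  move=> _; rewrite big_ord0 /= diracE mem_set//; by case.
move=> mB; rewrite big_ord_recl -IHn; last by move=> i; exact: mB.
rewrite /= /lebesgue_step /pushforward.
rewrite -product_measure1E//; last first.
  rewrite [X in measurable X](_ : _ =
      \bigcap_(i in [set: 'I_n]) [set x : 'cV[R]_n | B (lift ord0 i) (x i ord0)]).
    apply: fin_bigcap_measurable => // i _.
    by rewrite -[X in measurable X]setTI; exact: (measurable_mx_coord i ord0).
  by apply/seteqP; split => x /= h i; [move=> _; exact: h | exact: h].
  exact: (mB ord0).
congr (product_measure1 _ _ _); apply/seteqP; split => -[a v] /=.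
  move=> h; split => [|i]; first by have := h ord0; rewrite mxE unlift_none.
  by have := h (lift ord0 i); rewrite mxE liftK.
move=> [h0 h] i; rewrite mxE.
by have [j ->|->] := unliftP ord0 i => /=; [exact: h | exact: h0].
Qed.

Section linear_algebra.
Context {R : realType}.
Implicit Types d : nat.

Definition dot d (u v : 'cV[R]_d) : R := \sum_(i < d) u i ord0 * v i ord0.

(* The norm `|u| of MathComp-Analysis on matrices is the sup norm. *)
Definition enorm d (u : 'cV[R]_d) : R := Num.sqrt (dot u u).

Definition mxdot d (A B : 'M[R]_d) : R := \tr (A^T *m B).

(* The singular values, with multiplicity: the square roots of the eigenvalues
   of A^T A, as diagonalized over R[i] by the spectral theorem. *)
Definition singular_value d (A : 'M[R]_d) (i : 'I_d) : R :=
  Num.sqrt (complex.Re (spectral_diag (map_mx (real_complex R) (A^T *m A)) ord0 i)).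

Definition nuclear_norm d (A : 'M[R]_d) : R := \sum_(i < d) singular_value A i.

Definition spectral_norm d (A : 'M[R]_d) : R :=
  \big[Num.max/0]_(i < d) singular_value A i.

Definition diag_block d (A : 'M[R]_d) (a : R) : 'M[R]_(d + 1) :=
  block_mx A 0 0 a%:M.

Definition psd d (A : 'M[R]_d) : Prop :=
  A^T = A /\ forall u : 'cV[R]_d, 0 <= dot u (A *m u).

End linear_algebra.

Section complex_functions.
Context {R : realType}.
Local Open Scope complex_scope.

Definition cis (x : R) : R[i] := cos x +i* sin x.

Definition cexp (z : R[i]) : R[i] := (expR (complex.Re z))%:C * cis (complex.Im z).

Definition Cintegral d (T : measurableType d) (mu : {measure set T -> \bar R})
    (f : T -> R[i]) : R[i] :=
  (\int[mu]_x complex.Re (f x)) +i* (\int[mu]_x complex.Im (f x)).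

Definition laplace (pi : probability R R) (z : R[i]) : R[i] :=
  Cintegral pi (fun t => cexp (- (t%:C * z))).

(* [zeta] is a continuous choice, along [phi], of an inverse of the map
   [L : {Re z > 0} -> C \ {0}]: [zeta u] stands for L^-1(phi u). Since [L] may
   fail to be injective (for L(z) = exp(-z) this is the distinguished
   logarithm), the branch may depend on [u] and not only on [phi u]. The value
   of [zeta] is left free where [phi u] is not in the range, and continuity is
   required only on [D]. *)
Definition continuous_inverse_along (L : R[i] -> R[i]) d (D : set 'cV[R]_d)
    (phi zeta : 'cV[R]_d -> R[i]) : Prop :=
  let E := [set u | D u /\ phi u <> 0 /\ exists z, 0 < complex.Re z /\ L z = phi u] in
  [/\ forall u, E u -> 0 < complex.Re (zeta u) /\ L (zeta u) = phi u,
      {within E, continuous (fun u => complex.Re (zeta u))} &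
      {within E, continuous (fun u => complex.Im (zeta u))}].

End complex_functions.

Section processes.
Context d0 (Omega : measurableType d0) (R : realType) (P : probability Omega R).
Variable d : nat.

(* Processes are indexed by R; only the times t >= 0 are meaningful. *)

Definition cadlag (V : topologicalType) (f : R -> V) : Prop :=
  (forall t : R, 0 <= t -> f s @[s --> t^'+] --> f t) /\
  (forall t : R, 0 < t -> exists l : V, f s @[s --> t^'-] --> l).

Record levy_measure (nu : {measure set 'cV[R]_d -> \bar R}) : Prop := {
  levy_measure_set0 : nu [set 0] = 0%E ;
  levy_measure_fin :
    (\int[nu]_x (Num.min 1 (enorm x ^+ 2))%:E < +oo)%E }.

Definition levy_Psi (gamma : 'cV[R]_d) (nu : {measure set 'cV[R]_d -> \bar R})
    (u : 'cV[R]_d) : R[i] :=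
  (0 +i* dot gamma u +
   Cintegral nu (fun x =>
     cis (dot x u) - 1 - (0 +i* (dot x u * (enorm x <= 1)%R%:R))))%C.

Definition levy_psi (Sigma : 'M[R]_d) (gamma : 'cV[R]_d)
    (nu : {measure set 'cV[R]_d -> \bar R}) (u : 'cV[R]_d) : R[i] :=
  ((- (2^-1 * dot u (Sigma *m u)))%:C + levy_Psi gamma nu u)%C.

Record levy_process (X : R -> Omega -> 'cV[R]_d) (Sigma : 'M[R]_d)
    (gamma : 'cV[R]_d) (nu : {measure set 'cV[R]_d -> \bar R}) : Prop := {
  levy_Sigma : psd Sigma ;
  levy_nu : levy_measure nu ;
  levy_measurable : forall t, 0 <= t -> measurable_fun setT (X t) ;
  levy_start : {ae P, forall omega, X 0 omega = 0} ;
  levy_cadlag : {ae P, forall omega, cadlag (X ^~ omega)} ;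
  levy_indep_increments : forall (k : nat) (t : nat -> R)
      (B : nat -> set 'cV[R]_d),
    0 <= t 0%N -> (forall j, t j <= t j.+1) -> (forall j, measurable (B j)) ->
    P (\bigcap_(j < k) [set omega | B j (X (t j.+1) omega - X (t j) omega)%R]) =
    (\prod_(j < k) P [set omega | B j (X (t j.+1) omega - X (t j) omega)%R])%E ;
  levy_stat_increments : forall (s t : R) (B : set 'cV[R]_d),
    0 <= s -> 0 <= t -> measurable B ->
    P [set omega | B (X (s + t) omega - X s omega)] =
    P [set omega | B (X t omega - X 0 omega)] ;
  levy_charfun : forall t u, 0 <= t ->
    Cintegral P (fun omega => cis (dot (X t omega) u)) =
    cexp (t%:C%C * levy_psi Sigma gamma nu u) }.

(* The increments and observations T_1, T_2, ... and Y_1, Y_2, ... are indexed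
   from 0 here and in [observation] below. *)
Definition increment (Tc : R -> Omega -> R) (j : nat) (omega : Omega) : R :=
  Tc j.+1%:R omega - Tc j%:R omega.

Record time_change (Tc : R -> Omega -> R) (pi : probability R R) : Prop := {
  tc_measurable : forall t, 0 <= t -> measurable_fun setT (Tc t) ;
  tc_start : {ae P, forall omega, Tc 0 omega = 0} ;
  tc_nondecreasing : {ae P, forall omega, forall s t,
    0 <= s -> s <= t -> Tc s omega <= Tc t omega} ;
  tc_cadlag : {ae P, forall omega, cadlag (Tc ^~ omega)} ;
  tc_stationary : forall (k h : nat) (B : nat -> set R),
    (forall j, measurable (B j)) ->
    P (\bigcap_(j < k) [set omega | B j (increment Tc (j + h) omega)]) =
    P (\bigcap_(j < k) [set omega | B j (increment Tc j omega)]) ;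
  tc_law : forall (j : nat) (B : set R), measurable B ->
    P [set omega | B (increment Tc j omega)] = pi B ;
  tc_pi_ge0 : pi [set t | 0 <= t] = 1%E }.

Definition independent_processes (X : R -> Omega -> 'cV[R]_d)
    (Tc : R -> Omega -> R) : Prop :=
  forall (k l : nat) (s t : nat -> R) (A : nat -> set 'cV[R]_d)
      (B : nat -> set R),
    (forall j, 0 <= s j) -> (forall j, 0 <= t j) ->
    (forall j, measurable (A j)) -> (forall j, measurable (B j)) ->
    let EX := \bigcap_(j < k) [set omega | A j (X (s j) omega)] in
    let ET := \bigcap_(j < l) [set omega | B j (Tc (t j) omega)] in
    P (EX `&` ET) = (P EX * P ET)%E.

Definition observation (X : R -> Omega -> 'cV[R]_d) (Tc : R -> Omega -> R)
    (j : nat) (omega : Omega) : 'cV[R]_d :=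
  X (Tc j.+1%:R omega) omega - X (Tc j%:R omega) omega.

End processes.

Section estimation.
Context {R : realType} {d : nat}.
Local Open Scope complex_scope.

Definition emp_charfun (n : nat) (Y : nat -> 'cV[R]_d) (u : 'cV[R]_d) : R[i] :=
  n%:R^-1 * \sum_(j < n) cis (dot u (Y j)).

Definition jump_intensity (nu : {measure set 'cV[R]_d -> \bar R}) : R :=
  if (nu setT < +oo)%E then fine (nu setT) else 0.

(* [weight_integrable] includes measurability of [w]. *)
Record weight (w : 'cV[R]_d -> R) : Prop := {
  weight_ge0 : forall u, 0 <= w u ;
  weight_integrable : (lebesgue_cv R d).-integrable setT (EFin \o w) ;
  weight_radial : forall u v, enorm u = enorm v -> w u = w v ;
  weight_support : forall u, w u != 0 -> 4^-1 < enorm u <= 2^-1 }.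

Variables (w : 'cV[R]_d -> R) (U : R).

Definition scaled_weight (u : 'cV[R]_d) : R := U ^- d * w (U^-1 *: u).

Definition Theta (u : 'cV[R]_d) : 'M[R]_d := (enorm u ^- 2) *: (u *m u^T).

Definition Theta_tilde (u : 'cV[R]_d) : 'M[R]_(d + 1) :=
  diag_block (Theta u) (2 * U ^+ 2 / enorm u ^+ 2).

Definition wnorm (A : 'M[R]_d) (a : R) : R :=
  Num.sqrt (\int[lebesgue_cv R d]_u
    (mxdot (Theta_tilde u) (diag_block A a) ^+ 2 * scaled_weight u)).

Variable psi : 'cV[R]_d -> R[i].

Definition residual (M : 'M[R]_d) (a : R) (u : 'cV[R]_d) : R :=
  2 / enorm u ^+ 2 * complex.Re (psi u) +
  mxdot (Theta_tilde u) (diag_block M (U ^- 2 * a)).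

Definition criterion (lambda : R) (M : 'M[R]_d) (a : R) : R :=
  \int[lebesgue_cv R d]_u (residual M a u ^+ 2 * scaled_weight u) +
  lambda * (nuclear_norm M + U ^- 2 * a).

Definition is_estimator (MM : set 'M[R]_d) (I : set R) (lambda : R)
    (Sigma_hat : 'M[R]_d) (alpha_hat : R) : Prop :=
  [/\ MM Sigma_hat, I alpha_hat &
    forall M a, MM M -> I a ->
      criterion lambda Sigma_hat alpha_hat <= criterion lambda M a].

Definition error_matrix (Sigma : 'M[R]_d) (alpha : R) : 'M[R]_(d + 1) :=
  2 *: \matrix_(i, j) \int[lebesgue_cv R d]_u
    (residual Sigma alpha u * Theta_tilde u i j * scaled_weight u).

(* Finiteness of the quadratic term of the criterion. Without it the integrals
   defining the criterion and the error matrix do not exist, and the real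
   valued integral of the library would return a default value. *)
Definition square_integrable_data : Prop :=
  measurable_fun [set u : 'cV[R]_d | U / 4 < enorm u <= U / 2]
    (fun u => complex.Re (psi u)) /\
  (\int[lebesgue_cv R d]_u
     ((2 / enorm u ^+ 2 * complex.Re (psi u)) ^+ 2 * scaled_weight u)%:E < +oo)%E.

End estimation.

(* Main.v *)
(* Expanding the criterion around the true (Sigma, alpha) writes it as a
   constant plus <R_n, Delta> + ||Delta||_w^2 plus the penalty, where
   Delta = diag(M - Sigma, U^-2 (a - alpha)). Comparing the minimiser with
   (M, alpha), M arbitrary, leaves <R_n, Delta_M - Delta_hat>, in which Sigma
   and alpha cancel; the trace duality |<A, B>| <= ||A||_oo ||B||_1 bounds it by
   lambda times the sum of both penalties, so that the penalty of the estimator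
   cancels and that of M doubles. Finiteness of all integrals comes from the
   boundedness of the weight matrix on the annulus supporting the weight, and
   from the scaling property of Lebesgue measure. *)
Require Import Defs.
From HB Require Import structures.
From mathcomp Require Import all_boot all_order all_algebra.
From mathcomp.real_closed Require Import complex.
From mathcomp Require Import all_classical all_reals all_analysis.
From mathcomp Require Import measurable_realfun ring lra.
Import Order.TTheory GRing.Theory Num.Theory.
Import numFieldNormedType.Exports.

Set Implicit Arguments.
Unset Strict Implicit.
Unset Printing Implicit Defensive.

Local Open Scope classical_set_scope.
Local Open Scope ring_scope.

(** * Singular values and the duality of spectral and nuclear norm *)

Section trace_duality.
Context {R : realType}.
Local Notation C := R[i].
Local Notation rc := (real_complex R).
Local Open Scope sesquilinear_scope.
Implicit Types d : nat.

Lemma map_real_complex_trmxC m n (A : 'M[R]_(m, n)) : (map_mx rc A)^t* = map_mx rc A^T.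
Proof. by apply/matrixP => i j; rewrite !mxE conj_Creal// complex_real. Qed.

Lemma trmxC_mul m n p (A : 'M[C]_(m, n)) (B : 'M[C]_(n, p)) :
  (A *m B)^t* = B^t* *m A^t*.
Proof. by rewrite trmx_mul map_mxM. Qed.

(** Vectors are complex rows, since the spectral theorem lives over [R[i]]; [u *m map_mx rc A^T] is
    the image of [u] under [A]. Adjunction then collects both matrices in the middle, where the Gram
    matrix appears for [B = A]. *)
Lemma dotmx_mulmx_tr d p (u v : 'rV[C]_d) (A B : 'M[R]_(p, d)) :
  dotmx (u *m map_mx rc B^T) (v *m map_mx rc A^T) =
  (u *m map_mx rc (B^T *m A) *m v^t*) 0 0.
Proof.
by rewrite dotmxE trmxC_mul map_real_complex_trmxC trmxK map_mxM/= !mulmxA.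
Qed.

Lemma row_mulmx_tr_row m n (Q : 'M[C]_(m, n)) (H : 'M[C]_n) i j :
  (row i Q *m H *m (row j Q)^t*) 0 0 = (Q *m H *m Q^t*) i j.
Proof. by rewrite -row_mul !mxE; apply: eq_bigr => k _; rewrite !mxE. Qed.

Lemma singular_value_ge0 d (A : 'M[R]_d) i : 0 <= singular_value A i.
Proof. exact: sqrtr_ge0. Qed.

Lemma nuclear_norm_ge0 d (A : 'M[R]_d) : 0 <= nuclear_norm A.
Proof. by apply: sumr_ge0 => i _; exact: singular_value_ge0. Qed.

Lemma spectral_norm_ge0 d (A : 'M[R]_d) : 0 <= spectral_norm A.
Proof. exact: bigmax_ge_id. Qed.

(** The Gram matrix is real symmetric, hence unitarily diagonalizable, and its eigenvalue at the row
    [q] of [Q] is the squared length of the image of [q] under [A]. *)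
Lemma spectral_gram d (A : 'M[R]_d)
    (Q := spectralmx (map_mx rc (A^T *m A))) :
  Q *m map_mx rc (A^T *m A) *m Q^t* =
  diag_mx (\row_i rc (singular_value A i ^+ 2)).
Proof.
set H := map_mx rc _ in Q *; pose D := spectral_diag H.
have uQ : Q \is unitarymx by exact: spectral_unitarymx.
have symH : H \is normalmx.
  apply: symmetric_normalmx; last by apply/mxOverP => i j; rewrite mxE complex_real.
  apply/is_hermitianmxP; rewrite expr0 scale1r map_mx_id//.
  by rewrite /H map_trmx trmx_mul trmxK.
have QHQ : Q *m H *m Q^t* = diag_mx D.
  have /orthomx_spectralP := symH; rewrite -/Q -/D => {1}->.
  by rewrite invmx_unitary// !mulmxA (unitarymxP uQ) mul1mx mulmxtVK.
rewrite QHQ; congr diag_mx; apply/rowP => i; rewrite mxE.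
(* In [R[i]] this order also says that the imaginary part vanishes, so neither the real part nor the
   square root in [singular_value] loses information. *)
have : 0 <= D ord0 i.
  have -> : D ord0 i = dotmx (row i Q *m map_mx rc A^T) (row i Q *m map_mx rc A^T).
    by rewrite dotmx_mulmx_tr -/H row_mulmx_tr_row QHQ mxE eqxx.
  exact: dnorm_ge0.
rewrite /singular_value -/H -/D; case: (D ord0 i) => a b.
by rewrite lecE/= => /andP[/eqP-> a0]; rewrite sqr_sqrtr.
Qed.

Lemma dotmx_unitary d (Q : 'M[C]_d) (u : 'rV[C]_d) : Q \is unitarymx ->
  dotmx (u *m Q) (u *m Q) = dotmx u u.
Proof. by move=> uQ; rewrite !dotmxE trmxC_mul mulmxA mulmxtVK. Qed.

(** In an eigenbasis of the Gram matrix the squared length of the image is a sum of squared singular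
    values times squared moduli of coordinates; each singular value is at most the largest. *)
Lemma spectral_norm_bound d (A : 'M[R]_d) (u : 'rV[C]_d) :
  dotmx (u *m map_mx rc A^T) (u *m map_mx rc A^T) <=
  rc (spectral_norm A ^+ 2) * dotmx u u.
Proof.
set Q := spectralmx (map_mx rc (A^T *m A)).
have uQ : Q \is unitarymx by exact: spectral_unitarymx.
(* Only the left side is rewritten here; on the right the length of [u] equals that of its
   coordinate vector [u *m Q^t*], because the basis is unitary. *)
have {1 2}-> : u = (u *m Q^t*) *m Q by rewrite -mulmxA mulmx1C ?mulmx1//; exact/unitarymxP.
rewrite -(dotmx_unitary u (Q := Q^t*)) ?trmxC_unitary//.
move: (u *m _) => v.
have -> : dotmx (v *m Q *m map_mx rc A^T) (v *m Q *m map_mx rc A^T) =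
    (v *m diag_mx (\row_i rc (singular_value A i ^+ 2)) *m v^t*) 0 0.
  by rewrite dotmx_mulmx_tr trmxC_mul -spectral_gram -/Q !mulmxA.
rewrite dotmxE !mxE mulr_sumr; apply: ler_sum => i _.
rewrite mul_mx_diag !mxE mulrAC mulrC ler_wpM2r ?mul_conjC_ge0//.
rewrite lecR ler_pXn2r ?nnegrE ?singular_value_ge0 ?spectral_norm_ge0//.
exact: le_bigmax.
Qed.

Lemma dotmx_CauchySchwarz d (u v : 'rV[C]_d) :
  `|dotmx u v| ^+ 2 <= dotmx u u * dotmx v v.
Proof. exact: CauchySchwarz. Qed.

(* In the orthonormal basis q_i formed by the rows of Q, \tr (B^T *m A) is the
   sum of the <B q_i, A q_i>, and |A q_i| = s i; Cauchy-Schwarz concludes. *)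
Lemma mxdot_le_unitary d (A B : 'M[R]_d) (Q : 'M[C]_d) (s : 'I_d -> R) :
  Q \is unitarymx -> (forall i, 0 <= s i) ->
  (forall i, dotmx (row i Q *m map_mx rc A^T) (row i Q *m map_mx rc A^T) =
             rc (s i ^+ 2)) ->
  `|mxdot B A| <= spectral_norm B * \sum_i s i.
Proof.
move=> uQ s0 QA; rewrite -lecR.
have -> : (`|mxdot B A|%:C = `|rc (mxdot B A)|)%C.
  by rewrite normc_def/= expr0n/= addr0 sqrtr_sqr.
have -> : rc (mxdot B A) =
    \sum_i dotmx (row i Q *m map_mx rc B^T) (row i Q *m map_mx rc A^T).
  transitivity (\tr (Q *m map_mx rc (B^T *m A) *m Q^t*)).
    rewrite mxtrace_mulC mulmxA (mulmx1C (unitarymxP uQ)) mul1mx.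
    by rewrite trace_map_mx.
  by apply: eq_bigr => i _; rewrite dotmx_mulmx_tr row_mulmx_tr_row.
rewrite mulr_sumr rmorph_sum/= (le_trans (ler_norm_sum _ _ _))//.
apply: ler_sum => i _.
have sB0 := mulr_ge0 (spectral_norm_ge0 B) (s0 i).
rewrite -(@ler_pXn2r _ 2) ?nnegrE ?normr_ge0 ?ler0c//.
rewrite (le_trans (dotmx_CauchySchwarz _ _))// QA.
have -> : (rc (spectral_norm B * s i)) ^+ 2 =
    rc (spectral_norm B ^+ 2) * rc (s i ^+ 2).
  by rewrite -rmorphXn/= exprMn rmorphM.
rewrite ler_wpM2r ?ler0c ?sqr_ge0//.
rewrite (le_trans (spectral_norm_bound _ _))//.
by have /row_unitarymxP -> := uQ; rewrite eqxx mulr1.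
Qed.

(** The unitary matrix [block_mx Q 0 0 1] diagonalizes the Gram matrix of the block-diagonal matrix,
    with the squares of the singular values of [A] and of [|a|] on the diagonal. Using this basis
    directly avoids matching the diagonalization of the large matrix with that of its block. *)
Lemma mxdot_diag_block d (A : 'M[R]_d) (a : R) (B : 'M[R]_(d + 1)) :
  `|mxdot B (diag_block A a)| <= spectral_norm B * (nuclear_norm A + `|a|).
Proof.
set Q := spectralmx (map_mx rc (A^T *m A)).
have uQ : Q \is unitarymx by exact: spectral_unitarymx.
pose s (i : 'I_(d + 1)) := match fintype.split i with
  | inl j => singular_value A j | inr _ => `|a| end.
have -> : nuclear_norm A + `|a| = \sum_i s i.
  rewrite big_split_ord/= big_ord1 /s; congr (_ + _).
    by apply: eq_bigr => i _; rewrite (unsplitK (inl i)).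
  by rewrite (unsplitK (inr ord0)).
pose Q1 : 'M[C]_(d + 1) := block_mx Q 0 0 1%:M.
have bT : Q1^t* = block_mx (Q^t*) 0 0 1%:M.
  by rewrite /Q1 tr_block_mx map_block_mx !trmx0 !map_mx0 trmx1 map_mx1.
apply: (@mxdot_le_unitary _ _ _ Q1).
- apply/unitarymxP; rewrite bT /Q1 mulmx_block !mulmx0 !mul0mx !addr0 add0r mulmx1.
  by rewrite (unitarymxP uQ) -scalar_mx_block.
- by move=> i; rewrite /s; case: fintype.split => // j; exact: singular_value_ge0.
- move=> i; rewrite dotmx_mulmx_tr row_mulmx_tr_row bT.
  have -> : (diag_block A a)^T *m diag_block A a =
      block_mx (A^T *m A) 0 0 (a ^+ 2)%:M.
    rewrite /diag_block tr_block_mx !trmx0 tr_scalar_mx mulmx_block.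
    by rewrite !mulmx0 !mul0mx !addr0 add0r -scalar_mxM.
  rewrite /Q1 map_block_mx !map_mx0 map_scalar_mx !mulmx_block.
  rewrite !mulmx0 !mul0mx !addr0 !add0r mulmx1 mul1mx ?mul0mx ?mulmx0 spectral_gram.
  rewrite /s; case: splitP => j ij.
    rewrite (_ : i = lshift 1 j); last exact: val_inj.
    by rewrite block_mxEul !mxE eqxx.
  rewrite (_ : i = rshift d j); last exact: val_inj.
  by rewrite block_mxEdr mulmx1 !mxE eqxx real_normK ?num_real.
Qed.
End trace_duality.

(** * Dilations and Lebesgue measure *)

Section scaling.
Context {R : realType}.
Local Open Scope ereal_scope.

Lemma measurable_scalemx n (c : R) :
  measurable_fun setT (fun x : 'cV[R]_n => (c *: x)%R).
Proof.
apply: measurable_fun_mxP => i j; under eq_fun do rewrite mxE.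
by apply: measurable_funM => //; exact: measurable_mx_coord.
Qed.

(** The pushforward under multiplication by [c], rescaled by [c], gives every half-open interval its
    length, and this determines Lebesgue measure. *)
Lemma lebesgue_measure_scale (c : R) (A : set R) : (0 < c)%R -> measurable A ->
  lebesgue_measure A = c%:E * lebesgue_measure ( *%R c @^-1` A).
Proof.
move=> c0 mA.
have mc : measurable_fun setT ( *%R c : measurableTypeR R -> measurableTypeR R).
  exact: mulrl_measurable.
rewrite (@lebesgue_measure_unique _ (mscale (NngNum (ltW c0))
  (measure_function_pushforward__canonical__measure_function_Measure
    (@lebesgue_measure R) mc)))// => _ [[a b]] /= _ <-.
rewrite /mscale/= /pushforward.
rewrite (_ : _ @^-1` _ = `](a / c)%R, (b / c)%R]%classic); last first.
  apply/seteqP; split => x /=;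
    by rewrite !in_itv/= ltr_pdivrMr// ler_pdivlMr// ![(x * c)%R]mulrC.
rewrite !lebesgue_measure_itv/= !lte_fin ltr_pM2r ?invr_gt0//.
case: ifPn => _; last by rewrite mule0.
by rewrite -!EFinB -EFinM -mulrBl mulrCA divff ?mulr1// gt_eqF.
Qed.

Lemma cv_consZ n (c : R) (p : measurableTypeR R * 'cV[R]_n) :
  cv_cons (c * p.1, c *: p.2)%R = (c *: cv_cons p)%R.
Proof.
by apply/colP => i; rewrite !mxE; case: unlift => [j|]; rewrite ?mxE.
Qed.

(** Induction on the dimension: a dilation acts on each factor of a rectangle, and a product measure
    is determined by rectangles. In dimension 0 the Dirac mass sits at the fixed point of every
    dilation. *)
Lemma lebesgue_cv_scale n (c : R) (A : set 'cV[R]_n) : (0 < c)%R ->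
  measurable A ->
  lebesgue_cv R n A =
  (c ^+ n)%:E * lebesgue_cv R n ((fun x => c *: x)%R @^-1` A).
Proof.
move=> c0; elim: n => [|n IHn] in A *.
  move=> mA; rewrite expr0 mul1e /= !diracE; congr (_%:R%:E).
  by congr nat_of_bool; apply/idP/idP; rewrite !inE/= scaler0.
move=> mA /=; rewrite /lebesgue_step /pushforward.
pose phi (p : measurableTypeR R * 'cV[R]_n) : measurableTypeR R * 'cV[R]_n :=
  (c * p.1, c *: p.2)%R.
have mphi : measurable_fun setT phi.
  apply: measurable_fun_pair.
    by apply: measurable_funM => //; exact: measurable_fst.
  exact: (measurableT_comp (measurable_scalemx c) measurable_snd).
have cn0 : (0 <= c ^+ n.+1)%R by rewrite exprn_ge0// ltW.
(* On abstract arguments: unification diverges on the measures themselves. *)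
have aux (x y x' y' : \bar R) : x' = c%:E * x -> y' = (c ^+ n)%:E * y ->
    (c ^+ n.+1)%:E * (x * y) = x' * y'.
  by move=> -> ->; rewrite exprS EFinM muleACA.
pose m' := mscale (NngNum cn0)
  (measure_function_pushforward__canonical__measure_function_Measure
    (@lebesgue_measure R \x lebesgue_cv R n) mphi).
rewrite (@product_measure_unique _ _ _ _ _ _ _ m'); last 2 first.
- move=> B D mB mD; transitivity ((c ^+ n.+1)%:E * (@lebesgue_measure R \x lebesgue_cv R n)
    (( *%R c @^-1` B) `*` ((fun x => c *: x)%R @^-1` D))) => //.
  have mcB : measurable ( *%R c @^-1` B : set (measurableTypeR R)).
    by rewrite -[X in measurable X]setTI; exact: mulrl_measurable.
  have mcD : measurable ((fun x => c *: x)%R @^-1` D : set 'cV[R]_n).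
    by rewrite -[X in measurable X]setTI; exact: measurable_scalemx.
  have -> : (@lebesgue_measure R \x lebesgue_cv R n)
      (( *%R c @^-1` B) `*` ((fun x => c *: x)%R @^-1` D)) =
      lebesgue_measure ( *%R c @^-1` B) *
      lebesgue_cv R n ((fun x => c *: x)%R @^-1` D).
    exact: product_measure1E.
  apply: aux; [exact: (lebesgue_measure_scale c0 mB) | exact: IHn].
- rewrite -[X in measurable X]setTI.
  exact: measurable_cv_cons.
transitivity ((c ^+ n.+1)%:E * (@lebesgue_measure R \x lebesgue_cv R n)
    (phi @^-1` (@cv_cons R n @^-1` A))).
  by [].
congr ((c ^+ n.+1)%:E * (@lebesgue_measure R \x lebesgue_cv R n) _).
by apply/funext => p; rewrite /preimage/= cv_consZ.
Qed.

Lemma integrable_scale n (c : R) (f : 'cV[R]_n -> R) : (0 < c)%R ->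
  (lebesgue_cv R n).-integrable setT (EFin \o f) ->
  (lebesgue_cv R n).-integrable setT (EFin \o (fun x => f (c *: x)%R)).
Proof.
move=> c0 /integrableP[mf foo].
have mc := @measurable_scalemx n c.
have cn0 : (0 <= c ^+ n)%R by rewrite exprn_ge0// ltW.
apply/integrableP; split; first exact: (measurableT_comp mf mc).
pose m' := mscale (NngNum cn0)
  (measure_function_pushforward__canonical__measure_function_Measure
    (lebesgue_cv R n) mc).
have m'E : \int[m']_x `|(f x)%:E| = \int[lebesgue_cv R n]_x `|(f x)%:E|.
  by apply: eq_measure_integral => A mA _; apply/esym; exact: lebesgue_cv_scale.
have mabs : measurable_fun setT (fun x => `|(f x)%:E|).
  by apply: measurableT_comp => //; exact: mf.
move: foo; rewrite /= -m'E ge0_integral_mscale//= ge0_integral_pushforward//.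
rewrite preimage_setT => foo.
have cn_gt0 : (0 < c ^+ n)%R by rewrite exprn_gt0.
(* The goal is multiplied by the positive factor [c ^+ n], which leaves the bound [+oo] unchanged
   and turns the goal into [foo]. *)
rewrite -(@lte_pmul2l _ (c ^+ n)%:E)//.
by rewrite gt0_muley// lte_fin.
Qed.

End scaling.

(** * Square integrability against a weight carried by a set *)

Section weighted_square_integrable.
Context d (T : measurableType d) (R : realType) (mu : {measure set T -> \bar R}).
Variables (D : set T) (q : T -> R).
Implicit Types f g : T -> R.
Hypothesis mD : measurable D.
Hypothesis q_ge0 : forall x, 0 <= q x.
Hypothesis q_int : mu.-integrable setT (EFin \o q).
Hypothesis q_supp : forall x, q x != 0 -> D x.

(** Measurability is asked on [D] only: the weight vanishes elsewhere, and the data are assumed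
    measurable just on the annulus. *)
Definition sq_integrable (f : T -> R) : Prop :=
  measurable_fun D f /\
  mu.-integrable setT (EFin \o (fun x => f x ^+ 2 * q x)).

Lemma integrable_EFinD f g : mu.-integrable setT (EFin \o f) ->
  mu.-integrable setT (EFin \o g) ->
  mu.-integrable setT (EFin \o (fun x => f x + g x)).
Proof. by move=> hf hg; exact: (integrableD measurableT hf hg). Qed.

Lemma integrable_EFinZ f k : mu.-integrable setT (EFin \o f) ->
  mu.-integrable setT (EFin \o (fun x => k * f x)).
Proof. exact: integrableZl. Qed.

(** Off [D] the weight is zero, so [f] may be replaced by its extension by zero from [D]. *)
Lemma measurable_mul_weight f : measurable_fun D f ->
  measurable_fun setT (fun x => f x * q x).
Proof.
move=> /(measurable_restrictT _ mD) mf.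
have mq : measurable_fun setT q by apply/measurable_EFinP; exact: measurable_int q_int.
rewrite (_ : (fun x => _) = (fun x => (f \_ D) x * q x)); last first.
  apply/funext => x; rewrite patchE; case: ifPn => // /negP xD.
  have [->|/q_supp Dx] := eqVneq (q x) 0; first by rewrite !mulr0.
  by exfalso; apply: xD; rewrite inE.
exact: measurable_funM.
Qed.

Lemma integrable_dominated (f g : T -> R) : measurable_fun D f ->
  (forall x, D x -> `|f x| <= g x) ->
  mu.-integrable setT (EFin \o (fun x => g x * q x)) ->
  mu.-integrable setT (EFin \o (fun x => f x * q x)).
Proof.
move=> mf fg; apply: le_integrable => //.
  by apply/measurable_EFinP; exact: measurable_mul_weight.
move=> x _; rewrite /= lee_fin !normrM (ger0_norm (q_ge0 x)).
have [->|/q_supp Dx] := eqVneq (q x) 0; first by rewrite !mulr0.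
by rewrite ler_wpM2r// (le_trans (fg _ Dx))// ler_norm.
Qed.

Lemma sq_integrableM f g : sq_integrable f -> sq_integrable g ->
  mu.-integrable setT (EFin \o (fun x => f x * g x * q x)).
Proof.
move=> [mf f2] [mg g2].
apply: (@integrable_dominated _ (fun x => f x ^+ 2 + g x ^+ 2)).
- exact: measurable_funM.
- move=> x _; rewrite normrM -[f x ^+ 2]real_normK ?num_real//.
  rewrite -[g x ^+ 2]real_normK ?num_real//.
  (* Three times the first square plus the second is four times [f^2 + g^2 - |f| |g|]. *)
  have := sqr_ge0 (`|f x| - `|g x|); have := sqr_ge0 (`|f x| + `|g x|); nra.
- by under eq_fun do rewrite mulrDl; exact: integrable_EFinD.
Qed.

Lemma sq_integrableD f g : sq_integrable f -> sq_integrable g ->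
  sq_integrable (fun x => f x + g x).
Proof.
move=> hf hg; split; first by apply: measurable_funD; [case: hf|case: hg].
have fg := sq_integrableM hf hg; case: hf => _ f2; case: hg => _ g2.
under eq_fun do rewrite sqrrD mulrDl mulrDl mulrnAl mulr2n.
by do 2 (apply: integrable_EFinD => //); exact: integrable_EFinD.
Qed.

Lemma sq_integrableZ f k : sq_integrable f -> sq_integrable (fun x => f x * k).
Proof.
move=> [mf f2]; split; first exact: measurable_funM.
under eq_fun do rewrite exprMn mulrAC mulrC.
exact: integrable_EFinZ.
Qed.

Lemma sq_integrable_bounded f k : measurable_fun D f ->
  (forall x, D x -> `|f x| <= k) -> sq_integrable f.
Proof.
move=> mf fk; split => //.
apply: (@integrable_dominated _ (fun=> k ^+ 2)).
- exact: measurable_funX.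
- move=> x /fk fxk; rewrite normrX ler_pXn2r ?nnegrE//.
  exact: le_trans fxk.
- exact: integrable_EFinZ.
Qed.

Lemma sq_integrable_sum (I : Type) (s : seq I) (g : I -> T -> R) :
  (forall i, sq_integrable (g i)) ->
  sq_integrable (fun x => \sum_(i <- s) g i x).
Proof.
move=> hg; elim: s => [|i s IHs].
  under eq_fun do rewrite big_nil.
  by apply: (@sq_integrable_bounded _ 0) => // x _; rewrite normr0.
by under eq_fun do rewrite big_cons; exact: sq_integrableD.
Qed.

Lemma Rintegral_sqrD f g : sq_integrable f -> sq_integrable g ->
  \int[mu]_x ((f x + g x) ^+ 2 * q x) =
  \int[mu]_x (f x ^+ 2 * q x) + 2 * \int[mu]_x (f x * g x * q x) +
  \int[mu]_x (g x ^+ 2 * q x).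
Proof.
move=> hf hg; have fg := sq_integrableM hf hg.
have f2 := hf.2; have g2 := hg.2.
have fg2 : mu.-integrable setT (EFin \o (fun x => 2 * (f x * g x * q x))).
  exact: integrable_EFinZ.
rewrite -RintegralZl// -!RintegralD//.
  by apply: eq_Rintegral => x _; ring.
exact: integrable_EFinD.
Qed.

Lemma Rintegral_sum_mul (I : Type) (s : seq I) f (g : I -> T -> R) (k : I -> R) :
  sq_integrable f -> (forall i, sq_integrable (g i)) ->
  \int[mu]_x (f x * (\sum_(i <- s) g i x * k i) * q x) =
  \sum_(i <- s) \int[mu]_x (f x * g i x * q x) * k i.
Proof.
move=> hf hg; elim: s => [|i s IHs].
  rewrite big_nil; under eq_Rintegral do rewrite big_nil mulr0 mul0r.
  by rewrite Rintegral_cst// mul0r.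
have fgi := sq_integrableM hf (hg i).
rewrite big_cons -IHs -RintegralZr// -RintegralD//.
- by apply: eq_Rintegral => x _; rewrite big_cons; ring.
- by under eq_fun do rewrite mulrC; exact: integrable_EFinZ.
- apply: sq_integrableM => //; apply: sq_integrable_sum => j.
  exact: sq_integrableZ.
Qed.

End weighted_square_integrable.

(** * The Euclidean norm: homogeneity, coordinates, measurability *)

Section euclidean_norm.
Context {R : realType} {d : nat}.
Implicit Types u : 'cV[R]_d.

Lemma enorm_ge0 u : 0 <= enorm u.
Proof. exact: sqrtr_ge0. Qed.

Lemma sqr_enorm u : enorm u ^+ 2 = dot u u.
Proof. by rewrite sqr_sqrtr// sumr_ge0// => i _; rewrite -expr2 sqr_ge0. Qed.

Lemma enormZ (c : R) u : 0 <= c -> enorm (c *: u) = c * enorm u.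
Proof.
move=> c0; rewrite -[in RHS](ger0_norm c0) -sqrtr_sqr.
rewrite -sqrtrM ?sqr_ge0//; congr Num.sqrt; rewrite /dot mulr_sumr.
by apply: eq_bigr => i _; rewrite !mxE; ring.
Qed.

Lemma normr_coord_le u i : `|u i ord0| <= enorm u.
Proof.
rewrite -sqrtr_sqr ler_wsqrtr// /dot (bigD1 i)//= -expr2 lerDl.
by rewrite sumr_ge0// => j _; rewrite -expr2 sqr_ge0.
Qed.

Lemma measurable_enorm : measurable_fun setT (@enorm R d).
Proof.
apply: (measurableT_comp (continuous_measurable_fun (@sqrt_continuous R))).
apply: measurable_sum => i.
by apply: measurable_funM; exact: measurable_mx_coord.
Qed.

Lemma measurable_annulus (a b : R) :
  measurable [set u : 'cV[R]_d | a < enorm u <= b].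
Proof.
rewrite -[X in measurable X]setTI.
rewrite (_ : [set u | _] = @enorm R d @^-1` `]a, b]%classic).
  by apply: measurable_enorm => //; exact: measurable_itv.
by apply/seteqP; split => u /=; rewrite in_itv.
Qed.

Lemma measurable_enormVn (n : nat) :
  measurable_fun setT (fun u : 'cV[R]_d => enorm u ^- n).
Proof.
(* The inverse is written as a real power, which is measurable on the whole line, including the
   singularity at 0. *)
under eq_fun do rewrite -exprVn -powR_inv1 ?enorm_ge0//.
apply: measurable_funX.
exact: (measurableT_comp (measurable_powR _) measurable_enorm).
Qed.

End euclidean_norm.

(** * The rescaled weight and the matrix [Theta_tilde] on its annulus *)

Section scaled_weight.
Context {R : realType} {d : nat}.
Variables (w : 'cV[R]_d -> R) (U : R).
Hypotheses (hw : weight w) (U1 : 1 < U).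
Local Notation mu := (lebesgue_cv R d).
Local Notation sw := (scaled_weight w U).
Local Notation D := [set u : 'cV[R]_d | U / 4 < enorm u <= U / 2].

Let U0 : 0 < U. Proof. exact: lt_trans U1. Qed.

Lemma scaled_weight_ge0 u : 0 <= sw u.
Proof. by rewrite mulr_ge0 ?(weight_ge0 hw)// invr_ge0 exprn_ge0// ltW. Qed.

Lemma scaled_weight_integrable : mu.-integrable setT (EFin \o sw).
Proof.
apply: integrable_EFinZ; apply: integrable_scale; first by rewrite invr_gt0.
exact: weight_integrable hw.
Qed.

Lemma scaled_weight_support u : sw u != 0 -> D u.
Proof.
rewrite mulf_eq0 negb_or => /andP[_ /(weight_support hw)] /=.
by rewrite enormZ ?invr_ge0 ?(ltW U0)// ltr_pdivlMl// ler_pdivrMl.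
Qed.

Local Notation sqint := (sq_integrable mu D sw).

Let mD : measurable D. Proof. exact: measurable_annulus. Qed.

Lemma Theta_tilde_sq_integrable i j : sqint (fun u => Theta_tilde U u i j).
Proof.
(* The entries of [Theta u] are at most 1 in modulus, and the corner is below 32 because
   [enorm u > U / 4], so that [2 U^2 / |u|^2 < 2 * 16]. *)
apply: (@sq_integrable_bounded _ _ _ _ _ _ mD scaled_weight_ge0
  scaled_weight_integrable scaled_weight_support _ 32).
  apply: measurable_funTS; under eq_fun do rewrite /Theta_tilde /diag_block mxE.
  case: splitP => k _; under eq_fun do rewrite mxE; case: splitP => l _.
  - under eq_fun do rewrite !mxE big_ord1 mxE.
    apply: measurable_funM; first exact: measurable_enormVn.
    by apply: measurable_funM; exact: measurable_mx_coord.
  - by under eq_fun do rewrite mxE; exact: measurable_cst.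
  - by under eq_fun do rewrite mxE; exact: measurable_cst.
  - under eq_fun do rewrite mxE -mulrnAl.
    apply: measurable_funM => //; exact: measurable_enormVn.
move=> u /= /andP[Uu _].
have u0 : 0 < enorm u by apply: lt_trans Uu; rewrite divr_gt0.
have u2 : 0 < enorm u ^+ 2 by rewrite exprn_gt0.
rewrite /Theta_tilde /diag_block mxE; case: splitP => k _; rewrite mxE.
all: case: splitP => l _; rewrite ?mxE ?normr0//.
  rewrite big_ord1 mxE normrM ger0_norm ?invr_ge0 ?(ltW u2)// ler_pdivrMl//.
  rewrite normrM (@le_trans _ _ (enorm u * enorm u))//.
    by rewrite ler_pM// normr_coord_le.
  by rewrite expr2; nra.
rewrite !ord1 eqxx mulr1n ger0_norm; last first.
  by rewrite divr_ge0 ?mulr_ge0 ?sqr_ge0// ltW.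
rewrite ler_pdivrMr//; have := U0; nra.
Qed.

End scaled_weight.

(** * Expansion of the criterion and the deterministic oracle inequality *)

Section error_expansion.
Context {R : realType} {d : nat}.

(** A single sum over pairs of indices lets the finite-sum lemmas for weighted integrals apply. *)
Lemma mxdotE n (A B : 'M[R]_n) :
  mxdot A B = \sum_(p : 'I_n * 'I_n) A p.1 p.2 * B p.1 p.2.
Proof.
rewrite -(pair_bigA _ (fun i j => A i j * B i j))/= exchange_big/=.
apply: eq_bigr => j _; rewrite mxE.
by apply: eq_bigr => i _; rewrite mxE.
Qed.

Lemma mxdotDr n (A B C : 'M[R]_n) : mxdot A (B + C) = mxdot A B + mxdot A C.
Proof. by rewrite /mxdot mulmxDr mxtraceD. Qed.

Lemma diag_blockD (A B : 'M[R]_d) (a b : R) :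
  diag_block (A + B) (a + b) = diag_block A a + diag_block B b.
Proof. by rewrite /diag_block add_block_mx !addr0 raddfD. Qed.

Variables (w : 'cV[R]_d -> R) (U : R) (psi : 'cV[R]_d -> R[i]).
Hypotheses (hw : weight w) (U1 : 1 < U) (hpsi : square_integrable_data w U psi).
Local Notation mu := (lebesgue_cv R d).
Local Notation sw := (scaled_weight w U).
Local Notation D := [set u : 'cV[R]_d | U / 4 < enorm u <= U / 2].
Local Notation sqint := (sq_integrable mu D sw).

Let mD : measurable D. Proof. exact: measurable_annulus. Qed.
Let sw0 := scaled_weight_ge0 hw U1.
Let swi := scaled_weight_integrable hw U1.
Let sws := scaled_weight_support hw U1.

Lemma mxdot_sq_integrable B : sqint (fun u => mxdot (Theta_tilde U u) B).
Proof.
have -> : (fun u => mxdot (Theta_tilde U u) B) = (fun u =>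
    \sum_(p : 'I_(d + 1) * 'I_(d + 1)) Theta_tilde U u p.1 p.2 * B p.1 p.2).
  by apply/funext => u; exact: mxdotE.
apply: (sq_integrable_sum mD sw0 swi sws) => p.
by apply: sq_integrableZ; exact: Theta_tilde_sq_integrable.
Qed.

Lemma residual_sq_integrable M a : sqint (residual U psi M a).
Proof.
apply: (sq_integrableD mD sw0 swi sws); last exact: mxdot_sq_integrable.
case: hpsi => mpsi ipsi.
have mf : measurable_fun D (fun u => 2 / enorm u ^+ 2 * complex.Re (psi u)).
  apply: measurable_funM => //; apply: measurable_funM => //.
  by apply: measurable_funTS; exact: measurable_enormVn.
split => //; apply/integrableP; split.
  apply/measurable_EFinP; apply: (measurable_mul_weight mD swi sws).
  exact: measurable_funX.
rewrite (eq_integral (fun u => ((2 / enorm u ^+ 2 * complex.Re (psi u)) ^+ 2 * sw u)%:E))//.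
by move=> u _ /=; rewrite ger0_norm// mulr_ge0// sqr_ge0.
Qed.

(** Pairing commutes with the entrywise integral, so [error_matrix] represents the cross term of the
    squared residual; its factor 2 is the one of the binomial formula. *)
Lemma mxdot_error_matrix S a B :
  mxdot (error_matrix w U psi S a) B =
  2 * \int[mu]_u (residual U psi S a u * mxdot (Theta_tilde U u) B * sw u).
Proof.
under eq_Rintegral do rewrite mxdotE.
rewrite (Rintegral_sum_mul mD sw0 swi sws)//; last 2 first.
- exact: residual_sq_integrable.
- by move=> p; exact: Theta_tilde_sq_integrable.
rewrite mxdotE mulr_sumr; apply: eq_bigr => p _.
by rewrite !mxE mulrA.
Qed.

Lemma sqr_wnorm A a : wnorm w U A a ^+ 2 =
  \int[mu]_u (mxdot (Theta_tilde U u) (diag_block A a) ^+ 2 * sw u).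
Proof.
by rewrite sqr_sqrtr// Rintegral_ge0// => u _; rewrite mulr_ge0// sqr_ge0.
Qed.

(** The residual is affine in [(M, a)], so moving the base point adds only a linear pairing. *)
Lemma residual_shift S M s a u : residual U psi M a u =
  residual U psi S s u +
  mxdot (Theta_tilde U u) (diag_block (M - S) (U ^- 2 * (a - s))).
Proof.
rewrite /residual -addrA -mxdotDr -diag_blockD [S + _]addrC subrK.
by rewrite -mulrDr [s + _]addrC subrK.
Qed.

Lemma criterion_expand lambda S M s a :
  criterion w U psi lambda M a =
  \int[mu]_u (residual U psi S s u ^+ 2 * sw u) +
  mxdot (error_matrix w U psi S s) (diag_block (M - S) (U ^- 2 * (a - s))) +
  wnorm w U (M - S) (U ^- 2 * (a - s)) ^+ 2 +
  lambda * (nuclear_norm M + U ^- 2 * a).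
Proof.
rewrite mxdot_error_matrix sqr_wnorm -(Rintegral_sqrD mD sw0 swi sws); last 2 first.
- exact: residual_sq_integrable.
- exact: mxdot_sq_integrable.
by rewrite /criterion; under eq_Rintegral do rewrite (residual_shift S M s a).
Qed.

(** Nonnegativity of [s] and [shat] makes the absolute value produced by trace duality equal to the
    corresponding term of the penalty. *)
Lemma estimator_oracle lambda (S Shat M : 'M[R]_d) (s shat : R) :
  0 <= s -> 0 <= shat ->
  spectral_norm (error_matrix w U psi S s) <= lambda ->
  criterion w U psi lambda Shat shat <= criterion w U psi lambda M s ->
  wnorm w U (Shat - S) (U ^- 2 * (shat - s)) ^+ 2 <=
  wnorm w U (M - S) 0 ^+ 2 + 2 * lambda * (nuclear_norm M + U ^- 2 * s).
Proof.
(* Both criteria are expanded around the same [(S, s)]; the competitor has scalar part [s], so its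
   scalar deviation becomes 0. *)
move=> s0 shat0 E_le; rewrite !(criterion_expand _ S _ s) subrr mulr0.
set E := error_matrix _ _ _ _ _ in E_le *.
have U20 : 0 <= U ^- 2 by rewrite invr_ge0 sqr_ge0.
have dual N a : 0 <= a ->
    `|mxdot E (diag_block N (U ^- 2 * a))| <= lambda * (nuclear_norm N + U ^- 2 * a).
  move=> a0; have Ua0 : 0 <= U ^- 2 * a by rewrite mulr_ge0.
  rewrite (le_trans (mxdot_diag_block _ _ _))// ger0_norm//.
  by rewrite ler_wpM2r// addr_ge0// nuclear_norm_ge0.
(* Additive form of the cancellation of [S] and [s] in the difference of the two deviations; duality
   then applies to [M] and [Shat] separately. *)
have : mxdot E (diag_block (M - S) 0) + mxdot E (diag_block Shat (U ^- 2 * shat)) =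
    mxdot E (diag_block (Shat - S) (U ^- 2 * (shat - s))) +
    mxdot E (diag_block M (U ^- 2 * s)).
  rewrite -!mxdotDr -!diag_blockD; congr (mxdot _ (diag_block _ _)).
    by rewrite addrAC [in RHS]addrAC [M + _]addrC.
  by rewrite mulrBr subrK add0r.
have := dual M s s0; have := dual Shat shat shat0.
rewrite !ler_norml -mulrA.
(* With pairings, norms, penalties and the common integral generalized, the claim is a linear
   consequence, the squared norms acting as atoms. *)
move: (mxdot E _) (mxdot E _) (mxdot E _) (mxdot E _) => x1 x2 x3 x4.
move: (wnorm _ _ _ _) (wnorm _ _ _ _) => n1 n2.
move: (lambda * _) (lambda * _) (\int[_]_u _) => l1 l2 c.
move=> /andP[h1 h2] /andP[h3 h4] h5 h6; lra.
Qed.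

End error_expansion.

Theorem proposition3p3 (R : realType) (d0 : measure_display)
    (Omega : measurableType d0) (P : probability Omega R) (d n : nat)
    (X : R -> Omega -> 'cV[R]_d) (Sigma : 'M[R]_d) (gamma : 'cV[R]_d)
    (nu : {measure set 'cV[R]_d -> \bar R})
    (Tc : R -> Omega -> R) (pi : probability R R)
    (w : 'cV[R]_d -> R) (U lambda : R) (MM : set 'M[R]_d) (I : set R)
    (Linv_phi : Omega -> 'cV[R]_d -> R[i])
    (Sigma_tilde : Omega -> 'M[R]_d) (alpha_tilde : Omega -> R) :
  (0 < d)%N -> (0 < n)%N ->
  levy_process P X Sigma gamma nu ->
  time_change P Tc pi ->
  independent_processes P X Tc ->
  weight w -> 1 < U -> 0 < lambda ->
  is_interval I -> I `<=` [set a | 0 <= a] ->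
  let alpha := jump_intensity nu in
  I alpha ->
  forall omega : Omega,
  let phi_n := emp_charfun n (fun j => observation X Tc j omega) in
  let psi_hat := fun u => - Linv_phi omega u in
  continuous_inverse_along (laplace pi) [set u | enorm u <= U / 2]
    phi_n (Linv_phi omega) ->
  square_integrable_data w U psi_hat ->
  is_estimator w U psi_hat MM I lambda (Sigma_tilde omega) (alpha_tilde omega) ->
  spectral_norm (error_matrix w U psi_hat Sigma alpha) <= lambda ->
  wnorm w U (Sigma_tilde omega - Sigma)
    (U ^- 2 * (alpha_tilde omega - alpha)) ^+ 2 <=
  inf [set wnorm w U (M - Sigma) 0 ^+ 2 +
           2 * lambda * (nuclear_norm M + U ^- 2 * alpha) | M in MM].
Proof.
move=> _ _ _ _ _ hw U1 _ _ I0 alpha Ialpha omega phi_n psi_hat _ hpsi.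
move=> [MMhat Ihat hat_min] E_le.
apply: lb_le_inf.
  (* A lower bound lies below the real infimum only for a nonempty set; the estimator itself is the
     element of [MM] needed. *)
  by eexists; exists (Sigma_tilde omega).
move=> _ [M MM_M <-].
apply: (estimator_oracle hw U1 hpsi) => //; first exact: I0.
  exact: I0.
(* The pair [(M, alpha)] is an admissible competitor because [alpha] belongs to [I]. *)
exact: hat_min.
Qed.
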